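(* Let $k\ge1$ be an integer, let $\mathcal H_R$ and $\mathcal H_P$ be finite-dimensional Hilbert spaces, and let $|\Psi\rangle\in\mathcal H_R\otimes\mathcal H_P$ be a unit vector. The optimal winning probability of the $k$-party quantum cloning game with target state $|\Psi\rangle$ is $$\omega^*(\Psi\text{-}\mathrm{QCG}_k)=\frac1k\Big\|\sum_{x\in[k]}|\Psi\rangle\langle\Psi|_{RP_x}\otimes\mathbb I_{P_0\ldots P_{x-1}P_{x+1}\ldots P_{k-1}}\Big\|,$$ where the operator inside the norm acts on $\mathcal H_R\otimes\mathcal H_{P_0}\otimes\cdots\otimes\mathcal H_{P_{k-1}}$ with each $\mathcal H_{P_i}$ a copy of $\mathcal H_P$, and $\|\cdot\|$ is the operator norm (Schatten $\infty$-norm).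
   Context: Notation: $[k]=\{0,\dots,k-1\}$; $\mathcal S(\mathcal H)$ is the set of density operators on $\mathcal H$; $|\Psi\rangle_{RP_x}$ denotes the vector $|\Psi\rangle$ on registers $R$ and $P_x$, and $\mathbb I$ is the identity on the indicated registers. The game $\Psi$-$\mathrm{QCG}_k$: a referee holds register $R$ with Hilbert space $\mathcal H_R$, and there are $k$ collaborating, non-communicating players $P_0,\dots,P_{k-1}$. Before the game the players prepare an arbitrary joint quantum state between themselves and the referee. The referee draws $x\in[k]$ uniformly at random and sends $x$ to all players, who then act locally. The players win iff the projection onto $|\Psi\rangle_{RP_x}$, of the referee's register and the final register of player $P_x$, succeeds. Formally, a strategy $S$ consists of: finite-dimensional auxiliary Hilbert spaces $\mathcal H_{E_0},\dots,\mathcal H_{E_{k-1}}$ of arbitrary dimension; registers $\mathcal H_{P_i}$, each a copy of $\mathcal H_P$; a state $\rho\in\mathcal S(\mathcal H_R\otimes\mathcal H_{P_0E_0}\otimes\cdots\otimes\mathcal H_{P_{k-1}E_{k-1}})$, where $\mathcal H_{P_iE_i}=\mathcal H_{P_i}\otimes\mathcal H_{E_i}$; and, for all $i,x\in[k]$, a completely positive trace-preserving map $\mathcal E^x_{P_iE_i\to P_i}$ from operators on $\mathcal H_{P_iE_i}$ to operators on $\mathcal H_{P_i}$. Its winning probability is $$\omega(\Psi\text{-}\mathrm{QCG}_k,S)=\frac1k\sum_{x\in[k]}\mathrm{Tr}\Big[|\Psi\rangle\langle\Psi|_{RP_x}\;\mathrm{Tr}_{P_i:\,i\ne x}\Big[\big(\mathrm{id}_R\otimes\bigotimes_{i\in[k]}\mathcal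 E^x_{P_iE_i\to P_i}\big)(\rho)\Big]\Big],$$ and $\omega^*(\Psi\text{-}\mathrm{QCG}_k)=\sup_S\omega(\Psi\text{-}\mathrm{QCG}_k,S)$, the supremum being over all strategies (over all auxiliary spaces). *)

(* Defs.v *)
From HB Require Import structures.
From mathcomp Require Import all_boot all_order all_algebra.
From mathcomp Require Import all_classical all_reals.
From mathcomp Require Import complex.

Set Implicit Arguments.
Unset Strict Implicit.
Unset Printing Implicit Defensive.

Import Order.TTheory GRing.Theory Num.Theory.
Local Open Scope ring_scope.
Local Open Scope sesquilinear_scope.

(* A finite-dimensional Hilbert space is given by a finite type [I] labelling
   an orthonormal basis, so that H ⊗ H' is labelled by [I * J] and ⊗_i H_i by
   [{dffun forall i, I i}].  Vectors and operators are MathComp matrices, whose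
   rows and columns are numbered through [enum_rank] / [enum_val]. *)
Notation ket C I := 'cV[C]_#|{: I}|.
Notation op C I := 'M[C]_#|{: I}|.

Section Operators.
Variable C : numClosedFieldType.

Definition entry (I : finType) (A : op C I) (a b : I) : C :=
  A (enum_rank a) (enum_rank b).

Definition mkop (I : finType) (f : I -> I -> C) : op C I :=
  \matrix_(a, b) f (enum_val a) (enum_val b).

(* |a><b| for basis labels a, b *)
Definition unit_op (I : finType) (a b : I) : op C I :=
  delta_mx (enum_rank a) (enum_rank b).

Definition ketbra (I : finType) (v : ket C I) : op C I := v *m v^t*.

(* The order of [C] makes [0 <= z] mean that z is real and nonnegative; hence
   Hermitian symmetry of A is a consequence. *)
Definition psd (n : nat) (A : 'M[C]_n) : Prop :=
  forall v : 'cV[C]_n, 0 <= (v^t* *m A *m v) 0 0.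

Definition density (n : nat) (A : 'M[C]_n) : Prop := psd A /\ \tr A = 1.

Definition tens_op (I J : finType) (A : op C I) (B : op C J) : op C (I * J) :=
  mkop (fun a b : I * J => entry A a.1 b.1 * entry B a.2 b.2).

Definition bigtens_op (K : finType) (I : K -> finType)
    (A : forall i, op C (I i)) : op C {dffun forall i, I i} :=
  mkop (fun a b : {dffun forall i, I i} => \prod_i entry (A i) (a i) (b i)).

(* Phi ⊗ Psi for (linear) maps on operators: the linear extension of
   |a><b| ⊗ |a'><b'| |-> Phi(|a><b|) ⊗ Psi(|a'><b'|). *)
Definition tens_map (I I' J J' : finType)
    (Phi : op C I -> op C I') (Psi : op C J -> op C J')
    (X : op C (I * J)) : op C (I' * J') :=
  \sum_(a : I * J) \sum_(b : I * J) entry X a b *: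
    tens_op (Phi (unit_op a.1 b.1)) (Psi (unit_op a.2 b.2)).

Definition bigtens_map (K : finType) (I J : K -> finType)
    (Phi : forall i, op C (I i) -> op C (J i))
    (X : op C {dffun forall i, I i}) : op C {dffun forall i, J i} :=
  \sum_(a : {dffun forall i, I i}) \sum_(b : {dffun forall i, I i})
    entry X a b *: bigtens_op (fun i => Phi i (unit_op (a i) (b i))).

Definition completely_positive (I J : finType) (Phi : op C I -> op C J) : Prop :=
  forall (n : nat) (X : op C ('I_n * I)),
    psd X -> psd (tens_map (fun Y : op C 'I_n => Y) Phi X).

Definition trace_preserving (I J : finType) (Phi : op C I -> op C J) : Prop :=
  forall X : op C I, \tr (Phi X) = \tr X.

Definition agree_off (K : finType) (I : K -> finType) (x : K)
    (f g : {dffun forall i, I i}) : bool :=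
  [forall i, (i != x) ==> (f i == g i)].

(* A on A-space ⊗ H_x  |->  A ⊗ identity on H_i for all i != x,
   with the tensor factors put back in their original order. *)
Definition extend_op (L K : finType) (I : K -> finType) (x : K)
    (A : op C (L * I x)) : op C (L * {dffun forall i, I i}) :=
  mkop (fun a b : L * {dffun forall i, I i} =>
    if agree_off x a.2 b.2 then entry A (a.1, a.2 x) (b.1, b.2 x) else 0).

(* partial trace over all H_i with i != x *)
Definition ptrace_off (L K : finType) (I : K -> finType) (x : K)
    (X : op C (L * {dffun forall i, I i})) : op C (L * I x) :=
  mkop (fun a b : L * I x =>
    \sum_(f : {dffun forall i, I i} | f x == a.2)
      \sum_(g : {dffun forall i, I i} | (g x == b.2) && agree_off x f g)
        entry X (a.1, f) (b.1, g)).

End Operators.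

Section Norms.
Variable R : realType.

Definition l2norm (n : nat) (v : 'cV[R[i]]_n) : R :=
  Num.sqrt (complex.Re ((v^t* *m v) 0 0)).

Definition opnorm (n : nat) (A : 'M[R[i]]_n) : R :=
  sup [set l2norm (A *m v) | v in [set v : 'cV[R[i]]_n | l2norm v <= 1]]%classic.

End Norms.

Section CloningGame.
Variables (R : realType) (k dR dP : nat).

Record strategy := Strategy {
  dimE : 'I_k -> nat;
  state : op R[i] ('I_dR * {dffun forall i : 'I_k, 'I_dP * 'I_(dimE i)});
  state_density : density state;
  (* [channel x i] is the map applied by player i on question x *)
  channel : forall x i : 'I_k,
    {linear op R[i] ('I_dP * 'I_(dimE i)) -> op R[i] 'I_dP};
  channel_cp : forall x i, completely_positive (channel x i);
  channel_tp : forall x i, trace_preserving (channel x i)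
}.

Definition final_state (S : strategy) (x : 'I_k) :
    op R[i] ('I_dR * {dffun forall i : 'I_k, 'I_dP}) :=
  tens_map (fun Y : op R[i] 'I_dR => Y)
    (bigtens_map (fun i => channel S x i)) (state S).

(* Each trace is a real number, so [complex.Re] only changes its type. *)
Definition win_prob (Psi : ket R[i] ('I_dR * 'I_dP)) (S : strategy) : R :=
  k%:R^-1 * \sum_(x < k)
    complex.Re (\tr (ketbra Psi *m ptrace_off x (final_state S x))).

Definition optimal_win_prob (Psi : ket R[i] ('I_dR * 'I_dP)) : R :=
  sup (range (win_prob Psi)).

(* |Psi><Psi| on registers R and P_x, tensored with the identity elsewhere *)
Definition win_proj (Psi : ket R[i] ('I_dR * 'I_dP)) (x : 'I_k) :
    op R[i] ('I_dR * {dffun forall i : 'I_k, 'I_dP}) :=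
  extend_op (I := fun=> 'I_dP) (x := x) (ketbra Psi).

End CloningGame.

(* Main.v *)
Require Import Defs.
From mathcomp Require Import all_boot all_order all_algebra.
From mathcomp Require Import all_classical all_reals.
From mathcomp Require Import complex ring.

Set Implicit Arguments.
Unset Strict Implicit.
Unset Printing Implicit Defensive.

Import Order.TTheory GRing.Theory Num.Theory.
Local Open Scope ring_scope.
Local Open Scope sesquilinear_scope.

(* Since the channels of the players other than P_x are trace preserving, only
   the channel of P_x matters on question x; hence the players may apply the
   channels E_i^i before the question arrives, and the winning probability is
   (1/k) tr (A sigma) for a single density operator sigma, where A is the sum of
   the projections.  This is at most ||A|| / k, as sigma is a mixture of pure
   states.  Conversely every pure state w can be prepared, so the optimal value
   bounds <w, A w> / k for all unit vectors w, and ||A|| is the supremum of these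
   because A is positive semidefinite. *)

(** * Products of sums as sums over dependent functions *)

Section Distributivity.
Variables (C : comNzRingType) (K : finType) (T : K -> finType).

(** Transport along [dffun_of_fprod], then [big_fprod], replaces dependent functions by plain
    functions into the tagged union of the [T i], where the non-dependent distributive law
    applies. *)
Lemma prod_sum_dffun (F : forall i, T i -> C) :
  \prod_i \sum_(j : T i) F i j =
  \sum_(f : {dffun forall i, T i}) \prod_i F i (f i).
Proof.
rewrite (reindex (@dffun_of_fprod K T)); last first.
  exact/onW_bij/dffun_of_fprod_bij.
under eq_bigl do rewrite /=.
have -> : \sum_(j : fprod T) \prod_i F i (dffun_of_fprod j i) =
    \sum_(j : fprod T) \prod_(i in K) [ffun t => F i t] (j i).
  by apply: eq_bigr => j _; apply: eq_bigr => i _; rewrite !ffunE.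
rewrite (@big_fprod _ _ _ _ _ _ _ (fun i => [ffun t => F i t])).
rewrite -(bigA_distr_big_dep _ (fun i => untag 0 [ffun t => F i t])).
apply: eq_bigr => i _; rewrite -(big_tag (fun i => [ffun t => F i t])).
by apply: eq_bigr => j _; rewrite ffunE.
Qed.

Lemma prod_sum_dffun2 (F : forall i, T i -> T i -> C) :
  \prod_i \sum_(s : T i) \sum_(t : T i) F i s t =
  \sum_(f : {dffun forall i, T i}) \sum_(g : {dffun forall i, T i})
    \prod_i F i (f i) (g i).
Proof.
rewrite prod_sum_dffun; apply: eq_bigr => f _; exact: prod_sum_dffun.
Qed.

End Distributivity.

(** * Operators through their entries at basis labels *)

Section Entries.
Variable C : numClosedFieldType.

Lemma sum_enum_rank (I : finType) (F : 'I_#|{: I}| -> C) :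
  \sum_i F i = \sum_(a : I) F (enum_rank a).
Proof. by rewrite (reindex enum_rank) //; exact/onW_bij/enum_rank_bij. Qed.

Lemma entryP (I : finType) (A B : op C I) : entry A =2 entry B -> A = B.
Proof.
move=> AB; apply/matrixP => i j.
by rewrite -(enum_valK i) -(enum_valK j); exact: AB.
Qed.

Lemma entry_mkop (I : finType) (f : I -> I -> C) a b : entry (mkop f) a b = f a b.
Proof. by rewrite /entry mxE !enum_rankK. Qed.

Lemma entry_mul (I : finType) (A B : op C I) a b :
  entry (A *m B) a b = \sum_c entry A a c * entry B c b.
Proof. by rewrite /entry mxE sum_enum_rank. Qed.

Lemma entry_sum (I L : finType) (F : L -> op C I) a b :
  entry (\sum_l F l) a b = \sum_l entry (F l) a b.
Proof. by rewrite /entry summxE. Qed.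

Lemma entry_scale (I : finType) c (A : op C I) a b :
  entry (c *: A) a b = c * entry A a b.
Proof. by rewrite /entry mxE. Qed.

Lemma entry_unit_op (I : finType) (a b p q : I) :
  entry (unit_op C a b) p q = (p == a)%:R * (q == b)%:R.
Proof.
by rewrite /entry mxE !(inj_eq enum_rank_inj) -natrM mulnb.
Qed.

Lemma mxtrace_entry (I : finType) (A : op C I) : \tr A = \sum_a entry A a a.
Proof. by rewrite /mxtrace sum_enum_rank. Qed.

Lemma entry_ketbra (I : finType) (v : ket C I) a b :
  entry (ketbra v) a b = v (enum_rank a) 0 * (v (enum_rank b) 0)^*.
Proof. by rewrite /entry mxE big_ord1 !mxE. Qed.

End Entries.

(** * Positive semidefinite matrices *)

Section Psd.
Variable C : numClosedFieldType.

Lemma trmxC_mul (m n p : nat) (A : 'M[C]_(m, n)) (B : 'M[C]_(n, p)) :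
  (A *m B)^t* = B^t* *m A^t*.
Proof. by rewrite trmx_mul map_mxM. Qed.

Lemma psd_gram (m n : nat) (B : 'M[C]_(n, m)) : psd (B *m B^t*).
Proof.
move=> v; rewrite mulmxA -mulmxA -{1}(trmxCK B) -trmxC_mul !mxE.
by apply: sumr_ge0 => i _; rewrite !mxE mulrC mul_conjC_ge0.
Qed.

Lemma psd_sum (L : finType) n (A : L -> 'M[C]_n) :
  (forall l, psd (A l)) -> psd (\sum_l A l).
Proof.
move=> A0 v; rewrite mulmx_sumr mulmx_suml summxE.
by apply: sumr_ge0 => l _; exact: A0.
Qed.

Lemma psd_conj m n (M : 'M[C]_(m, n)) (A : 'M[C]_n) :
  psd A -> psd (M *m A *m M^t*).
Proof.
move=> A0 v; have := A0 (M^t* *m v).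
by rewrite trmxC_mul trmxCK !mulmxA.
Qed.

(** Polarization: at [u + c *: v] only the two cross terms survive. Taking [c = 'i] makes them equal
    and [c = 1] makes them opposite, so both vanish. *)
Lemma form0_eq0 n (H : 'M[C]_n) :
  (forall v : 'cV[C]_n, (v^t* *m H *m v) 0 0 = 0) -> H = 0.
Proof.
move=> H0.
have bil (u v : 'cV[C]_n) c :
    (u^t* *m H *m v) 0 0 * c + (v^t* *m H *m u) 0 0 * c^* = 0.
  have := H0 (u + c *: v).
  have -> : (u + c *: v)^t* = u^t* + c^* *: v^t*.
    by rewrite linearD linearZ /= map_mxD map_mxZ.
  rewrite !mulmxDl !mulmxDr -!scalemxAl -!scalemxAr.
  have H00 (w : 'cV[C]_n) : w^t* *m H *m w = 0.
    by apply/matrixP => i j; rewrite !ord1 H0 mxE.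
  rewrite !H00 scaler0 scaler0 add0r addr0.
  move: (u^t* *m H *m v) (v^t* *m H *m u) => X Y; rewrite !mxE => <-.
  by rewrite mulrC [X in _ + X]mulrC.
have H2 (u v : 'cV[C]_n) : (u^t* *m H *m v) 0 0 = 0.
  have := bil u v 1; have := bil u v 'i.
  rewrite conjCi rmorph1 !mulr1 mulrN -mulrBl => /eqP.
  rewrite mulf_eq0 (negPf (neq0Ci C)) orbF subr_eq0 => /eqP <-.
  by move/eqP; rewrite -mulr2n mulrn_eq0 => /eqP.
apply/matrixP => i j; rewrite [RHS]mxE.
rewrite -(H2 (delta_mx i 0) (delta_mx j 0)).
rewrite trmx_delta map_delta_mx -rowE -colE.
by rewrite !mxE.
Qed.

(** The form of [A - A^t*] at [v] is z minus its conjugate, where z is the form of [A] at [v] and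
    hence real. *)
Lemma psd_hermitian n (A : 'M[C]_n) : psd A -> A = A^t*.
Proof.
move=> A0; apply/eqP; rewrite -subr_eq0; apply/eqP/form0_eq0 => v.
have -> : v^t* *m (A - A^t*) *m v = v^t* *m A *m v - (v^t* *m A *m v)^t*.
  by rewrite !trmxC_mul trmxCK mulmxBr mulmxBl !mulmxA.
have /ger0_real/CrealP := A0 v.
by move: (v^t* *m A *m v) => X X_real; rewrite !mxE X_real subrr.
Qed.

(** By the spectral theorem, [A] is unitarily diagonal. Its form at the eigenvectors gives
    nonnegative eigenvalues, and their square roots define [B]. *)
Lemma psd_factor n (A : 'M[C]_n) : psd A -> exists B : 'M[C]_n, A = B *m B^t*.
Proof.
move=> A0; have hA : A \is hermsymmx.
  by apply/is_hermitianmxP; rewrite expr0 scale1r; exact: psd_hermitian.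
have /orthomx_spectralP := hermitian_normalmx hA.
set P := spectralmx A; set d := spectral_diag A => AE.
have PU : P \is unitarymx := spectral_unitarymx A.
rewrite invmx_unitary // in AE.
have d0 i : 0 <= d 0 i.
  have := A0 (P^t* *m delta_mx i 0).
  rewrite AE trmxC_mul trmxCK !mulmxA.
  rewrite -[_ *m P *m P^t*]mulmxA (unitarymxP PU) mulmx1.
  rewrite -[_ *m P *m P^t*]mulmxA (unitarymxP PU) mulmx1.
  rewrite trmx_delta map_delta_mx -rowE -colE !mxE.
  by rewrite eqxx.
exists (P^t* *m diag_mx (map_mx sqrtC d)).
rewrite trmxC_mul trmxCK tr_diag_mx map_diag_mx !mulmxA.
rewrite -[_ *m diag_mx _ *m diag_mx _]mulmxA.
rewrite mulmx_diag {1}AE; congr (_ *m diag_mx _ *m _).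
apply/rowP => i; rewrite !mxE.
by rewrite /= geC0_conj ?sqrtC_ge0 // -expr2 sqrtCK.
Qed.

End Psd.

(** * Sums and products of Kronecker deltas *)

Section Sums.
Variable C : comNzRingType.

Lemma sum_delta (I : finType) (a : I) (F : I -> C) :
  \sum_i (a == i)%:R * F i = F a.
Proof.
rewrite (bigD1 a) //= eqxx mul1r big1 ?addr0 // => i /negPf ia.
by rewrite eq_sym ia mul0r.
Qed.

Lemma prod_delta (K : finType) (T : K -> finType) (f g : {dffun forall i, T i}) :
  \prod_i (f i == g i)%:R = (f == g)%:R :> C.
Proof.
have [->|fg] := eqVneq f g; first by rewrite big1 // => i _; rewrite eqxx.
have /existsP[i fgi] : [exists i, f i != g i].
  by apply: contraNT fg => /existsPn fg; apply/eqP/ffunP => i; apply/eqP/negbNE/fg.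
by rewrite (bigD1 i) //= (negPf fgi) mul0r.
Qed.

Lemma sum_pair (I J : finType) (F : I * J -> C) :
  \sum_p F p = \sum_i \sum_j F (i, j).
Proof. by rewrite pair_bigA; apply: eq_bigr => -[]. Qed.

End Sums.

(** * Kraus operators of completely positive maps *)

Section LocalMaps.
Variable C : numClosedFieldType.

(** The hypothesis says that Y is the sum over l of M_l X M_l^†. It is phrased with labels, so that
    Kraus operators can be given as functions on labels with any finite index type. *)
Lemma psd_kraus (I J L : finType) (M : L -> J -> I -> C) (X : op C I) (Y : op C J) :
  psd X ->
  (forall p q, entry Y p q =
    \sum_l \sum_a \sum_b M l p a * entry X a b * (M l q b)^*) ->
  psd Y.
Proof.
move=> X0 YE.
pose N l : 'M[C]_(#|{: J}|, #|{: I}|) :=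
  \matrix_(i, j) M l (enum_val i) (enum_val j).
have -> : Y = \sum_l N l *m X *m (N l)^t*.
  apply: entryP => p q; rewrite YE entry_sum; apply: eq_bigr => l _.
  rewrite exchange_big /entry mxE sum_enum_rank; apply: eq_bigr => b _.
  rewrite mxE sum_enum_rank mulr_suml; apply: eq_bigr => a _.
  by rewrite !mxE !enum_rankK.
by apply: psd_sum => l; exact: psd_conj.
Qed.

Lemma entry_tens_map_id (L I J : finType) (Phi : op C I -> op C J)
    (X : op C (L * I)) p q :
  entry (tens_map (fun Y : op C L => Y) Phi X) p q =
  \sum_a \sum_b entry X (p.1, a) (q.1, b) * entry (Phi (unit_op C a b)) p.2 q.2.
Proof.
rewrite /tens_map entry_sum sum_pair.
under eq_bigr => r _ do under eq_bigr => a _ do rewrite entry_sum sum_pair.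
transitivity (\sum_r (p.1 == r)%:R * \sum_a \sum_r' (q.1 == r')%:R *
  \sum_b entry X (r, a) (r', b) * entry (Phi (unit_op C a b)) p.2 q.2).
  apply: eq_bigr => r _; rewrite mulr_sumr; apply: eq_bigr => a _.
  rewrite mulr_sumr; apply: eq_bigr => r' _.
  rewrite 2!mulr_sumr; apply: eq_bigr => b _.
  rewrite entry_scale entry_mkop entry_unit_op /=.
  by rewrite mulrCA -!mulrA; congr (_ * _); rewrite mulrCA.
by rewrite sum_delta; apply: eq_bigr => a _; rewrite sum_delta.
Qed.

(* The columns of a factor of the Choi matrix of [Phi] are its Kraus operators. *)
Lemma completely_positive_kraus (I J : finType) (Phi : op C I -> op C J) :
  completely_positive Phi ->
  exists M : 'I_#|{: 'I_#|{: I}| * J}| -> J -> I -> C, forall a b p q,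
    entry (Phi (unit_op C a b)) p q = \sum_l M l p a * (M l q b)^*.
Proof.
move=> /(_ #|{: I}|) cpPhi.
(* This is the unnormalised maximally entangled vector; the ancilla labels are the ranks of the
   labels in [I], since complete positivity is stated for ancillas ['I_n]. *)
pose v : ket C ('I_#|{: I}| * I) :=
  \col_j ((enum_val j).1 == enum_rank (enum_val j).2)%:R.
have [B BE] := psd_factor (cpPhi _ (psd_gram v)).
exists (fun l p a => B (enum_rank (enum_rank a, p)) l) => a b p q.
have -> : \sum_l B (enum_rank (enum_rank a, p)) l *
    (B (enum_rank (enum_rank b, q)) l)^* =
    entry (B *m B^t*) (enum_rank a, p) (enum_rank b, q).
  by rewrite /entry mxE; apply: eq_bigr => l _; rewrite !mxE.
rewrite -BE entry_tens_map_id /=.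
have -> : v *m v^t* = ketbra v by [].
transitivity (\sum_a' (a == a')%:R * \sum_b' (b == b')%:R *
  entry (Phi (unit_op C a' b')) p q).
  by rewrite sum_delta sum_delta.
apply: eq_bigr => a' _; rewrite mulr_sumr; apply: eq_bigr => b' _.
rewrite entry_ketbra !mxE !enum_rankK /= !(inj_eq enum_rank_inj).
by rewrite conjC_nat mulrA.
Qed.

(** * Tensor products of local maps *)

Section BigTensor.
Variables (K L : finType) (I J : K -> finType).
Variable Phi : forall i, op C (I i) -> op C (J i).
Implicit Type X : op C (L * {dffun forall i, I i}).

(** With the channels of question x as [Phi], this is [final_state]; a general family is allowed so
    that channels of different questions can be combined. *)
Definition local_maps X : op C (L * {dffun forall i, J i}) :=
  tens_map (fun Y : op C L => Y) (bigtens_map Phi) X.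

Lemma bigtens_map_unit (a b : {dffun forall i, I i}) :
  bigtens_map Phi (unit_op C a b) = bigtens_op (fun i => Phi (unit_op C (a i) (b i))).
Proof.
apply: entryP => p q; rewrite /bigtens_map entry_sum.
under eq_bigr => a' _ do rewrite entry_sum.
transitivity (\sum_a' (a == a')%:R * \sum_b' (b == b')%:R *
  entry (bigtens_op (fun i => Phi (unit_op C (a' i) (b' i)))) p q).
  apply: eq_bigr => a' _; rewrite mulr_sumr; apply: eq_bigr => b' _.
  by rewrite entry_scale entry_unit_op (eq_sym a') (eq_sym b') mulrA.
by rewrite !sum_delta.
Qed.

Lemma entry_local_maps X p q :
  entry (local_maps X) p q =
  \sum_a \sum_b entry X (p.1, a) (q.1, b) *
    \prod_i entry (Phi (unit_op C (a i) (b i))) (p.2 i) (q.2 i).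
Proof.
rewrite /local_maps entry_tens_map_id; apply: eq_bigr => a _; apply: eq_bigr => b _.
by rewrite bigtens_map_unit entry_mkop.
Qed.

Lemma psd_local_maps X :
  (forall i, completely_positive (@Phi i)) -> psd X -> psd (local_maps X).
Proof.
move=> cpPhi X0.
pose kraus i := cid (completely_positive_kraus (cpPhi i)).
pose M i := sval (kraus i); have ME i := svalP (kraus i).
(* The index [l] picks one Kraus operator per factor; [N l] is their tensor product with the
   identity on [L]. *)
pose N (l : {dffun forall i, 'I_#|{: 'I_#|{: I i}| * J i}|})
    (p : L * {dffun forall i, J i}) (a : L * {dffun forall i, I i}) :=
  (p.1 == a.1)%:R * \prod_i M i (l i) (p.2 i) (a.2 i).
apply: (psd_kraus (M := N) X0) => p q; rewrite entry_local_maps.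
transitivity (\sum_a \sum_b
    \sum_(l : {dffun forall i, 'I_#|{: 'I_#|{: I i}| * J i}|}) entry X (p.1, a) (q.1, b) *
  ((\prod_i M i (l i) (p.2 i) (a i)) * (\prod_i M i (l i) (q.2 i) (b i))^*)).
  apply: eq_bigr => a _; apply: eq_bigr => b _; rewrite -mulr_sumr; congr (_ * _).
  under eq_bigr => i _ do rewrite ME -/(M i).
  rewrite prod_sum_dffun; apply: eq_bigr => l _.
  by rewrite big_split rmorph_prod.
under eq_bigr => a _ do rewrite exchange_big.
rewrite exchange_big; apply: eq_bigr => l _.
rewrite sum_pair.
transitivity (\sum_r (p.1 == r)%:R * \sum_a \sum_r' (q.1 == r')%:R *
  \sum_b entry X (r, a) (r', b) *
  ((\prod_i M i (l i) (p.2 i) (a i)) * (\prod_i M i (l i) (q.2 i) (b i))^*)).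
  by rewrite sum_delta; apply: eq_bigr => a _; rewrite sum_delta.
apply: eq_bigr => r _; rewrite mulr_sumr; apply: eq_bigr => a _.
rewrite sum_pair mulr_sumr; apply: eq_bigr => r' _.
rewrite 2!mulr_sumr; apply: eq_bigr => b _.
rewrite /N /= rmorphM /= conjC_nat -!mulrA; congr (_ * _).
by rewrite mulrCA [RHS]mulrCA; congr (_ * _); rewrite mulrCA.
Qed.

(** The sum over diagonal labels factors into the traces of the [Phi i] at matrix units. Each trace
    is a delta, and their product forces [a = b]. *)
Lemma mxtrace_local_maps X :
  (forall i, trace_preserving (@Phi i)) -> \tr (local_maps X) = \tr X.
Proof.
move=> tpPhi; rewrite !mxtrace_entry !sum_pair; apply: eq_bigr => r _.
under eq_bigr => f _ do rewrite entry_local_maps.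
rewrite exchange_big; apply: eq_bigr => a _.
rewrite exchange_big /= -[RHS](sum_delta a (fun b => entry X (r, a) (r, b))).
apply: eq_bigr => b _; rewrite -mulr_sumr mulrC; congr (_ * _).
rewrite -(prod_sum_dffun (fun i s => entry (Phi (unit_op C (a i) (b i))) s s)).
rewrite -prod_delta; apply: eq_bigr => i _.
rewrite -mxtrace_entry tpPhi mxtrace_entry.
under eq_bigr => s _ do rewrite entry_unit_op eq_sym.
by rewrite sum_delta.
Qed.

End BigTensor.

(** * Partial traces and no-signalling *)

(** Partial trace and tensoring with the identity are adjoint for the trace pairing: both sides are
    one sum, once full labels are grouped by their x-components [s] and [t]. *)
Lemma mxtrace_ptrace_off (K L : finType) (I : K -> finType) (x : K)
    (A : op C (L * I x)) (Y : op C (L * {dffun forall i, I i})) :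
  \tr (A *m ptrace_off x Y) = \tr (extend_op A *m Y).
Proof.
have agreeC (f g : {dffun forall i, I i}) : agree_off x f g = agree_off x g f.
  by apply: eq_forallb => i; rewrite (eq_sym (f i)).
rewrite !mxtrace_entry.
under eq_bigr => p _ do rewrite entry_mul sum_pair.
under [in RHS]eq_bigr => p _ do rewrite entry_mul sum_pair.
rewrite !sum_pair; apply: eq_bigr => r _.
rewrite [RHS](partition_big (fun g : {dffun forall i, I i} => g x) xpredT) //=.
apply: eq_bigr => s _; rewrite exchange_big /= [RHS]exchange_big /=.
rewrite [LHS]exchange_big /=; apply: eq_bigr => r' _.
under [in RHS]eq_bigr => g _ do
  rewrite (partition_big (fun f : {dffun forall i, I i} => f x) xpredT) //=.
rewrite [RHS]exchange_big; apply: eq_bigr => t _ /=.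
rewrite entry_mkop mulr_sumr [RHS]exchange_big /=.
apply: eq_bigr => f /eqP ft; rewrite mulr_sumr.
rewrite [RHS]big_mkcond [LHS]big_mkcond; apply: eq_bigr => g _.
have [gs|//] := eqVneq (g x) s; rewrite /= entry_mkop /= agreeC.
by case: ifP => _; rewrite ?mul0r // gs ft.
Qed.

(** No-signalling: the partial trace sees the maps off [x] only through the traces of their outputs,
    and trace preservation fixes those. *)
Lemma ptrace_off_local_maps (K L J : finType) (I : K -> finType) (x : K)
    (Phi Phi' : forall i, op C (I i) -> op C J) (X : op C (L * {dffun forall i, I i})) :
  (forall i, trace_preserving (Phi i)) -> (forall i, trace_preserving (Phi' i)) ->
  Phi x = Phi' x ->
  ptrace_off x (local_maps (J := fun=> J) Phi X) =
  ptrace_off x (local_maps (J := fun=> J) Phi' X).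
Proof.
move=> tpPhi tpPhi' PhiE; apply: entryP => p q.
(* [c] makes the index condition of [ptrace_off] a product over the players, so
   that the sums over labels distribute over the tensor factors. *)
pose c i (s t : J) : C := (if i == x then (s == p.2) && (t == q.2) else s == t)%:R.
(* The double sum at [i = x] is the entry of the output at [p.2], [q.2]; at any other [i] it is the
   trace of the output. *)
suff red (Xi : forall i, op C (I i) -> op C J) :
    entry (ptrace_off x (local_maps (J := fun=> J) Xi X)) p q =
    \sum_a \sum_b entry X (p.1, a) (q.1, b) *
      \prod_i \sum_s \sum_t c i s t * entry (Xi i (unit_op C (a i) (b i))) s t.
  rewrite !red; apply: eq_bigr => a _; apply: eq_bigr => b _; congr (_ * _).
  apply: eq_bigr => i _; rewrite /c; have [->|_] := eqVneq i x; first by rewrite PhiE.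
  under eq_bigr => s _ do rewrite sum_delta.
  under [in RHS]eq_bigr => s _ do rewrite sum_delta.
  by rewrite -!mxtrace_entry tpPhi tpPhi'.
rewrite entry_mkop.
transitivity (\sum_(f : {dffun forall i : K, J}) \sum_(g : {dffun forall i : K, J})
   (\prod_i c i (f i) (g i)) * entry (local_maps (J := fun=> J) Xi X) (p.1, f) (q.1, g)).
  rewrite big_mkcond; apply: eq_bigr => f _.
  have cE (g : {dffun forall i : K, J}) : \prod_i c i (f i) (g i) =
      ((f x == p.2) && ((g x == q.2) && agree_off x f g))%:R.
    rewrite (bigD1 x) //= /c eqxx.
    have -> : \prod_(i | i != x) (if i == x then (f i == p.2) && (g i == q.2)
        else f i == g i)%:R = (agree_off x f g)%:R :> C.
      rewrite /agree_off.
      have [fg|/existsNP[i /negP]] := fintype.forallP.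
        by rewrite big1 // => i ix; rewrite (negPf ix); move: (fg i); rewrite ix /= => ->.
      by rewrite negb_imply => /andP[ix /negPf fgi];
        rewrite (bigD1 i) //= (negPf ix) fgi mul0r.
    by rewrite -natrM mulnb andbA.
  under [in RHS]eq_bigr => g _ do rewrite cE.
  case: (f x == p.2) => /=; last by rewrite big1 // => g _; rewrite mul0r.
  rewrite big_mkcond; apply: eq_bigr => g _.
  by case: ifP => _; rewrite ?mul1r ?mul0r.
under eq_bigr => f _ do under eq_bigr => g _ do rewrite entry_local_maps mulr_sumr.
under eq_bigr => f _ do rewrite exchange_big.
rewrite exchange_big; apply: eq_bigr => a _ /=.
under eq_bigr => f _ do under eq_bigr => g _ do rewrite mulr_sumr.
under eq_bigr => f _ do rewrite exchange_big.
rewrite exchange_big; apply: eq_bigr => b _ /=.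
rewrite (prod_sum_dffun2 (T := fun=> J)
  (fun i s t => c i s t * entry (Xi i (unit_op C (a i) (b i))) s t)).
rewrite mulr_sumr; apply: eq_bigr => f _; rewrite mulr_sumr; apply: eq_bigr => g _.
by rewrite mulrCA -big_split.
Qed.

End LocalMaps.

(** * Euclidean norm, operator norm and quadratic forms *)

Section Norms.
Variable R : realType.
Local Notation C := R[i].
Local Open Scope complex_scope.

Lemma Re_sum (I : finType) (F : I -> C) :
  complex.Re (\sum_i F i) = \sum_i complex.Re (F i).
Proof. by apply: (big_morph (@complex.Re R)) => // -[a b] [c d]. Qed.

Lemma ler_Re (x y : C) : x <= y -> complex.Re x <= complex.Re y.
Proof. by rewrite lecE => /andP[]. Qed.

Lemma Re_realM (c : R) (z : C) : complex.Re (c%:C * z) = c * complex.Re z.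
Proof. by case: z => a b /=; rewrite mul0r subr0. Qed.

Lemma ip_ge0 n (v : 'cV[C]_n) : 0 <= (v^t* *m v) 0 0.
Proof.
by rewrite mxE; apply: sumr_ge0 => i _; rewrite !mxE mulrC mul_conjC_ge0.
Qed.

Lemma l2norm_ge0 n (v : 'cV[C]_n) : 0 <= l2norm v.
Proof. exact: sqrtr_ge0. Qed.

Lemma sqr_l2norm n (v : 'cV[C]_n) : l2norm v ^+ 2 = complex.Re ((v^t* *m v) 0 0).
Proof. by rewrite sqr_sqrtr //; exact: (ler_Re (ip_ge0 v)). Qed.

Lemma ip_l2norm n (v : 'cV[C]_n) : (v^t* *m v) 0 0 = (l2norm v ^+ 2)%:C.
Proof. by rewrite sqr_l2norm RRe_real // ger0_real // ip_ge0. Qed.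

Lemma l2norm_eq0 n (v : 'cV[C]_n) : l2norm v = 0 -> v = 0.
Proof.
move=> v0; have := ip_l2norm v; rewrite v0 expr0n /= mxE => /eqP.
rewrite psumr_eq0 => [/allP vi|i _]; last by rewrite !mxE mulrC mul_conjC_ge0.
apply/colP => i; have := vi i (mem_index_enum _).
by rewrite !mxE mulrC mul_conjC_eq0 => /eqP.
Qed.

Lemma trmxCZ_real m n (c : R) (A : 'M[C]_(m, n)) : (c%:C *: A)^t* = c%:C *: A^t*.
Proof. by rewrite linearZ /= map_mxZ /= conj_Creal // complex_real. Qed.

Lemma l2normZ n c (v : 'cV[C]_n) : 0 <= c -> l2norm (c%:C *: v) = c * l2norm v.
Proof.
move=> c0; apply/eqP; rewrite -(eqrXn2 (n := 2)) ?mulr_ge0 ?l2norm_ge0 //.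
rewrite exprMn !sqr_l2norm trmxCZ_real.
by rewrite -scalemxAl -scalemxAr scalerA -rmorphM [X in complex.Re X]mxE Re_realM expr2.
Qed.

Lemma Re_ip_sym n (u v : 'cV[C]_n) :
  complex.Re ((v^t* *m u) 0 0) = complex.Re ((u^t* *m v) 0 0).
Proof.
have -> : v^t* *m u = (u^t* *m v)^t* by rewrite trmxC_mul trmxCK.
by rewrite !mxE; case: (\sum_j _).
Qed.

(** Cauchy-Schwarz: with a, b the norms of [u], [v], the squared norm of b u - a v is 2ab(ab -
    Re<u,v>), which is nonnegative. *)
Lemma Re_ip_le n (u v : 'cV[C]_n) :
  complex.Re ((u^t* *m v) 0 0) <= l2norm u * l2norm v.
Proof.
have [u0|] := eqVneq (l2norm u) 0.
  by rewrite u0 mul0r (l2norm_eq0 u0) trmx0 map_mx0 mul0mx mxE.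
have [v0|v0 u0] := eqVneq (l2norm v) 0.
  by rewrite v0 mulr0 (l2norm_eq0 v0) mulmx0 mxE.
have uv0 : 0 < l2norm u * l2norm v by rewrite mulr_gt0 // lt_def ?u0 ?v0 l2norm_ge0.
set a := l2norm u in u0 uv0 *; set b := l2norm v in v0 uv0 *.
have tD (w z : 'cV[C]_n) : (w + z)^t* = w^t* + z^t* by rewrite linearD /= map_mxD.
have ReD (x y : C) : complex.Re (x + y) = complex.Re x + complex.Re y by case: x; case: y.
pose q (w z : 'cV[C]_n) := complex.Re ((w^t* *m z) 0 0).
have ql (z : 'cV[C]_n) : q (b%:C *: u + (- a)%:C *: v) z = b * q u z - a * q v z.
  rewrite /q tD !trmxCZ_real mulmxDl -!scalemxAl.
  by move: (u^t* *m z) (v^t* *m z) => X Y; rewrite !mxE ReD !Re_realM mulNr.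
have qr (w : 'cV[C]_n) : q w (b%:C *: u + (- a)%:C *: v) = b * q w u - a * q w v.
  rewrite /q mulmxDr -!scalemxAr.
  by move: (w^t* *m u) (w^t* *m v) => X Y; rewrite !mxE ReD !Re_realM mulNr.
have : 0 <= q (b%:C *: u + (- a)%:C *: v) (b%:C *: u + (- a)%:C *: v).
  exact: ler_Re (ip_ge0 _).
rewrite ql !qr [q v u]Re_ip_sym -/(q u v).
have -> : q u u = a ^+ 2 by rewrite sqr_l2norm.
have -> : q v v = b ^+ 2 by rewrite sqr_l2norm.
have -> : b * (b * a ^+ 2 - a * q u v) - a * (b * q u v - a * b ^+ 2) =
    2 * (a * b) * (a * b - q u v) by ring.
by rewrite pmulr_rge0 ?subr_ge0 //; exact: mulr_gt0.
Qed.

(** A crude bound from row sums, as entries of [v] have modulus at most 1. It makes the [sup] in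
    [opnorm] an actual upper bound. *)
Lemma l2norm_mulmx_bounded m n (A : 'M[C]_(m, n)) :
  exists M, forall v, l2norm v <= 1 -> l2norm (A *m v) <= M.
Proof.
exists (Num.sqrt (complex.Re (\sum_i (\sum_j `|A i j|) ^+ 2))) => v v1.
have vj j : `|v j 0| <= 1.
  rewrite -(expr_le1 (n := 2)) // normCKC.
  have : (v^t* *m v) 0 0 <= 1.
    by rewrite ip_l2norm -(rmorph1 (real_complex R)) lecR expr_le1 // l2norm_ge0.
  apply: le_trans; rewrite mxE (bigD1 j) //= !mxE lerDl.
  by apply: sumr_ge0 => i _; rewrite !mxE mulrC mul_conjC_ge0.
apply/ler_wsqrtr/ler_Re; rewrite mxE; apply: ler_sum => i _.
rewrite !mxE -normCKC lerXn2r ?nnegrE ?sumr_ge0 //.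
apply: le_trans (ler_norm_sum _ _ _) _; apply: ler_sum => j _.
by rewrite normrM ler_piMr.
Qed.

Lemma l2norm_opnorm n (A : 'M[C]_n) v : l2norm (A *m v) <= opnorm A * l2norm v.
Proof.
have ub (w : 'cV[C]_n) : l2norm w <= 1 -> l2norm (A *m w) <= opnorm A.
  move=> w1; apply: ub_le_sup; last by exists w.
  by have [M AM] := l2norm_mulmx_bounded A; exists M => _ [u /AM ? <-].
have [v0|v0] := eqVneq (l2norm v) 0.
  by rewrite v0 mulr0 (l2norm_eq0 v0) mulmx0 /l2norm mulmx0 mxE /= sqrtr0.
have v_gt0 : 0 < l2norm v by rewrite lt_def v0 l2norm_ge0.
have := ub ((l2norm v)^-1%:C *: v).
rewrite -scalemxAr !l2normZ ?invr_ge0 ?l2norm_ge0 // mulVf // lexx => /(_ isT).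
by rewrite mulrC ler_pdivrMr.
Qed.

(** With D = B B^†, the trace is the sum of <b, A b> over the columns b of [B], whose squared norms
    sum to 1. Each term is at most [opnorm A] times the squared norm of b. *)
Lemma Re_mxtrace_density n (A D : 'M[C]_n) :
  density D -> complex.Re (\tr (A *m D)) <= opnorm A.
Proof.
case=> /psd_factor[B ->]; rewrite mulmxA !(mxtrace_mulC _ (B^t*)) => trD.
have diag_col (X : 'M[C]_n) l :
    (B^t* *m (X *m B)) l l = ((col l B)^t* *m (X *m col l B)) 0 0.
  rewrite !mxE; apply: eq_bigr => i _; rewrite !mxE; congr (_ * _).
  by apply: eq_bigr => j _; rewrite !mxE.
have {}trD : \sum_l l2norm (col l B) ^+ 2 = 1.
  have : complex.Re (\tr (B^t* *m B)) = 1 by rewrite trD.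
  rewrite /mxtrace Re_sum => <-.
  apply: eq_bigr => l _; have := diag_col 1%:M l.
  by rewrite !mul1mx => ->; rewrite sqr_l2norm.
rewrite /mxtrace Re_sum -[leRHS]mulr1 -trD mulr_sumr; apply: ler_sum => l _.
rewrite diag_col; apply: le_trans (Re_ip_le _ _) _.
rewrite expr2 mulrCA; apply: ler_wpM2l; first exact: l2norm_ge0.
exact: l2norm_opnorm.
Qed.

(* Cauchy-Schwarz for the semi-inner product [<u, A v>]. *)
Lemma psd_l2norm_le n (A : 'M[C]_n) (m : R) :
  psd A -> 0 <= m ->
  (forall v : 'cV[C]_n, complex.Re ((v^t* *m A *m v) 0 0) <= m * l2norm v ^+ 2) ->
  forall v : 'cV[C]_n, l2norm (A *m v) <= m * l2norm v.
Proof.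
move=> /psd_factor[B AE] m0 Am v.
have Bm u : l2norm (B^t* *m u) <= Num.sqrt m * l2norm u.
  rewrite -(ler_pXn2r (n := 2)) ?nnegrE ?mulr_ge0 ?sqrtr_ge0 ?l2norm_ge0 //.
  rewrite exprMn (sqr_sqrtr m0) [X in X <= _]sqr_l2norm trmxC_mul trmxCK.
  by rewrite mulmxA -[_ *m B *m _]mulmxA -AE.
have [->|w0] := eqVneq (l2norm (A *m v)) 0; first by rewrite mulr_ge0 ?l2norm_ge0.
have w_gt0 : 0 < l2norm (A *m v) by rewrite lt_def w0 l2norm_ge0.
(* Cauchy-Schwarz on this identity, with [Bm] for both factors, bounds the squared norm of [A *m v]
   by m times the norms of [A *m v] and [v]; one factor then cancels. *)
have ipE : (A *m v)^t* *m (A *m v) = (B^t* *m (A *m v))^t* *m (B^t* *m v).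
  by rewrite trmxC_mul trmxCK {2}AE !mulmxA.
rewrite -(ler_pM2l w_gt0) -expr2 [X in X <= _]sqr_l2norm ipE.
apply: le_trans (Re_ip_le _ _) _.
apply: le_trans (ler_pM _ _ (Bm _) (Bm _)) _; rewrite ?l2norm_ge0 //.
by rewrite mulrACA -expr2 (sqr_sqrtr m0) mulrCA.
Qed.

End Norms.

(** * Positivity under relabelling and under tensoring with the identity *)

Section Reindexing.
Variable C : numClosedFieldType.

(** [Y] is [X] conjugated by the 0-1 matrix of [h], a single Kraus operator. *)
Lemma psd_reindex (I J : finType) (h : J -> I) (X : op C I) (Y : op C J) :
  psd X -> (forall p q, entry Y p q = entry X (h p) (h q)) -> psd Y.
Proof.
move=> X0 YE; apply: (psd_kraus (M := fun (_ : unit) p a => (h p == a)%:R) X0) => p q.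
rewrite YE big_const card_unit /= addr0.
rewrite -[LHS](sum_delta (h p) (fun a => entry X a (h q))); apply: eq_bigr => a _.
under eq_bigr => b _ do rewrite conjC_nat mulrC.
by rewrite sum_delta.
Qed.

(** The Kraus operators tensor with one basis vector of the factors off [x], and are indexed by its
    label. *)
Lemma psd_extend_op (L K : finType) (I : K -> finType) (x : K) (A : op C (L * I x)) :
  psd A -> psd (extend_op A).
Proof.
move=> A0.
(* [erase f] forgets the x-th component of [f], so that [agree_off x f g] is an
   equality of labels and can be resolved over a common Kraus index. *)
pose erase (f : {dffun forall i, I i}) : {dffun forall i, option (I i)} :=
  [ffun i => if i == x then None else Some (f i)].
have eraseE f g : agree_off x f g = (erase f == erase g).
  apply/fintype.forallP/eqP => [fg|fg i].
    apply/ffunP => i; rewrite !ffunE; move: (fg i).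
    by case: (i == x) => //= /eqP ->.
  apply/implyP => /negPf ix; move/ffunP/(_ i): fg.
  by rewrite !ffunE ix => -[->].
pose M l (p : L * {dffun forall i, I i}) (a : L * I x) : C :=
  (erase p.2 == l)%:R * ((p.1, p.2 x) == a)%:R.
apply: (psd_kraus (M := M) A0) => p q; rewrite entry_mkop.
(* Only the index [erase p.2] contributes; there the factor for [q] is the agreement test [e]. *)
rewrite (bigD1 (erase p.2)) //= [X in _ + X]big1 ?addr0 => [|l /negPf pl]; last first.
  rewrite big1 // => a _; rewrite big1 // => b _.
  by rewrite /M [erase _ == _]eq_sym pl !mul0r.
pose e : C := (erase q.2 == erase p.2)%:R.
transitivity (\sum_a ((p.1, p.2 x) == a)%:R *
    \sum_b ((q.1, q.2 x) == b)%:R * (e * entry A a b)).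
  rewrite !sum_delta eraseE eq_sym /e.
  by case: (_ == _); rewrite ?mul1r ?mul0r.
apply: eq_bigr => a _; rewrite mulr_sumr; apply: eq_bigr => b _.
rewrite /M eqxx rmorphM /= !conjC_nat mul1r -!mulrA; congr (_ * _).
by rewrite mulrCA [RHS]mulrC -mulrA.
Qed.

End Reindexing.

(** * Winning probabilities of strategies *)

Section Game.
Variables (R : realType) (k dR dP : nat).
Local Notation C := R[i].
Implicit Type Psi : ket C ('I_dR * 'I_dP).

(** On question x the channels may be replaced by the family [channel S i i], which agrees with them
    at player x. The resulting state is the same for all x, so the sum moves onto the
    projections. *)
Lemma win_probE Psi (S : strategy R k dR dP) :
  win_prob Psi S = k%:R^-1 * complex.Re (\tr ((\sum_(x < k) win_proj Psi x) *m
    local_maps (fun i => channel S i i) (state S))).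
Proof.
congr (_ * _); rewrite mulmx_suml (big_morph _ (@mxtraceD _ _) (mxtrace0 _ _)) Re_sum.
apply: eq_bigr => x _.
rewrite /win_proj -(mxtrace_ptrace_off (I := fun=> 'I_dP)).
apply: (congr1 (fun Z => complex.Re (\tr (ketbra Psi *m Z)))).
exact: (ptrace_off_local_maps (I := fun i => ('I_dP * 'I_(dimE S i))%type)
  (Phi := fun i => channel S x i) _ (@channel_tp _ _ _ _ S x)
  (fun i => @channel_tp _ _ _ _ S i i)).
Qed.

Lemma psd_win_proj Psi (x : 'I_k) : psd (win_proj Psi x).
Proof. exact/psd_extend_op/psd_gram. Qed.

Lemma win_prob_le Psi (S : strategy R k dR dP) :
  win_prob Psi S <= k%:R^-1 * opnorm (\sum_(x < k) win_proj Psi x).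
Proof.
rewrite win_probE ler_wpM2l ?invr_ge0 ?ler0n //; apply: Re_mxtrace_density.
have [X0 trX] := state_density S.
split; first by apply: psd_local_maps => // i; exact: channel_cp.
by rewrite mxtrace_local_maps // => i; exact: channel_tp.
Qed.

(* The spaces E_i are one-dimensional and every channel only discards E_i. *)
Section PreparedState.
Variable w : ket C ('I_dR * {dffun forall i : 'I_k, 'I_dP}).

Definition add_trivial (p : 'I_dP) : 'I_dP * 'I_1 := (p, ord0).

(** Tracing out a one-dimensional space only relabels entries, so it can be written as a submatrix,
    which is linear by construction. *)
Definition discard : {linear op C ('I_dP * 'I_1) -> op C 'I_dP} :=
  let h j := enum_rank (add_trivial (enum_val j)) in mxsub h h.

Lemma entry_discard X p q :
  entry (discard X) p q = entry X (add_trivial p) (add_trivial q).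
Proof. by rewrite /entry mxE !enum_rankK. Qed.

Lemma discard_cp : completely_positive discard.
Proof.
move=> n X X0.
apply: (psd_reindex (h := fun p : 'I_n * 'I_dP => (p.1, add_trivial p.2)) X0) => p q.
rewrite entry_tens_map_id.
transitivity (\sum_a (add_trivial p.2 == a)%:R * \sum_b (add_trivial q.2 == b)%:R *
    entry X (p.1, a) (q.1, b)).
  apply: eq_bigr => a _; rewrite mulr_sumr; apply: eq_bigr => b _.
  by rewrite entry_discard entry_unit_op mulrC mulrA.
by rewrite !sum_delta.
Qed.

Lemma discard_tp : trace_preserving discard.
Proof.
move=> X; rewrite !mxtrace_entry sum_pair; apply: eq_bigr => p _.
by rewrite big_ord1 entry_discard.
Qed.

Definition add_trivials (p : {dffun forall i : 'I_k, 'I_dP}) :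
  {dffun forall i : 'I_k, 'I_dP * 'I_1} := [ffun i => add_trivial (p i)].

Definition drop_trivials (a : {dffun forall i : 'I_k, 'I_dP * 'I_1}) :
  {dffun forall i : 'I_k, 'I_dP} := [ffun i => (a i).1].

Lemma add_trivialsK : cancel add_trivials drop_trivials.
Proof. by move=> p; apply/ffunP => i; rewrite !ffunE. Qed.

Lemma drop_trivialsK : cancel drop_trivials add_trivials.
Proof.
move=> a; apply/ffunP => i; rewrite !ffunE /add_trivial.
by case: (a i) => p e; rewrite (ord1 e).
Qed.

Definition prepared : op C ('I_dR * {dffun forall i : 'I_k, 'I_dP * 'I_1}) :=
  ketbra (\col_j let a := enum_val j in w (enum_rank (a.1, drop_trivials a.2)) 0).

Lemma entry_prepared a b : entry prepared a b =
  entry (ketbra w) (a.1, drop_trivials a.2) (b.1, drop_trivials b.2).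
Proof. by rewrite !entry_ketbra !mxE !enum_rankK. Qed.

Hypothesis w_unit : l2norm w = 1.

Lemma prepared_density : density prepared.
Proof.
split; first exact: psd_gram.
rewrite mxtrace_entry sum_pair.
transitivity (\tr (ketbra w)).
  rewrite mxtrace_entry sum_pair; apply: eq_bigr => r _.
  rewrite (reindex add_trivials) /=; last first.
    by apply: onW_bij; exists drop_trivials; [exact: add_trivialsK|exact: drop_trivialsK].
  by apply: eq_bigr => p _; rewrite entry_prepared /= add_trivialsK.
by rewrite mxtrace_mulC trace_mx11 ip_l2norm w_unit expr1n.
Qed.

Definition prepare : strategy R k dR dP :=
  @Strategy R k dR dP (fun=> 1%N) prepared prepared_density (fun _ _ => discard)
    (fun _ _ => discard_cp) (fun _ _ => discard_tp).

(** Discarding the trivial spaces turns [prepared] back into [ketbra w], and tracing against it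
    gives the quadratic form at [w]. *)
Lemma win_prob_prepare Psi : win_prob Psi prepare =
  k%:R^-1 * complex.Re ((w^t* *m (\sum_(x < k) win_proj Psi x) *m w) 0 0).
Proof.
rewrite win_probE; congr (_ * complex.Re _).
have -> : local_maps (fun i => channel prepare i i) (state prepare) = ketbra w.
  apply: entryP => p q; rewrite entry_local_maps /=.
  transitivity (\sum_a (add_trivials p.2 == a)%:R * \sum_b (add_trivials q.2 == b)%:R *
      entry prepared (p.1, a) (q.1, b)).
    apply: eq_bigr => a _; rewrite mulr_sumr; apply: eq_bigr => b _.
    rewrite -!prod_delta mulrA -big_split /= mulrC; congr (_ * _).
    by apply: eq_bigr => i _; rewrite entry_discard entry_unit_op !ffunE.
  rewrite !sum_delta entry_prepared /= !add_trivialsK.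
  by case: p q => [? ?] [? ?].
by rewrite mulmxA mxtrace_mulC mulmxA trace_mx11.
Qed.

End PreparedState.

Lemma exists_unit_ket (I : finType) (a : I) : exists w : ket C I, l2norm w = 1.
Proof.
exists (delta_mx (enum_rank a) 0).
by rewrite /l2norm trmx_delta map_delta_mx mul_delta_mx mxE !eqxx /= sqrtr1.
Qed.

End Game.

(** * The two inequalities for the optimal value *)

Theorem theorem3 (R : realType) (k dR dP : nat) (k_ge1 : (1 <= k)%N)
    (Psi : ket R[i] ('I_dR * 'I_dP)) (Psi_unit : l2norm Psi = 1) :
  optimal_win_prob k Psi =
  k%:R^-1 * opnorm (\sum_(x < k) win_proj Psi x).
Proof.
set A := \sum_(x < k) _.
have k_gt0 : 0 < k%:R :> R by rewrite ltr0n.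
have A_psd : psd A by apply: psd_sum => x; exact: psd_win_proj.
(* A unit vector [Psi] forces both dimensions to be positive. The labels give a unit vector [w],
   hence a strategy, so the supremum is over a nonempty set. *)
have [r p] : 'I_dR * 'I_dP.
  case: (pickP (fun _ : 'I_dR * 'I_dP => true)) => [//|none].
  exfalso; move: Psi_unit; rewrite /l2norm mxE sum_enum_rank big1 /= => [|a _].
    by rewrite sqrtr0 => /eqP; rewrite eq_sym oner_eq0.
  by have := none a.
have [w w_unit] := exists_unit_ket R (r, [ffun=> p] : {dffun forall i : 'I_k, 'I_dP}).
have win_bounded : has_ubound (range (@win_prob R k dR dP Psi)).
  by exists (k%:R^-1 * opnorm A) => _ [S _ <-]; exact: win_prob_le.
pose s := optimal_win_prob k Psi.
have win_le (v : ket R[i] ('I_dR * {dffun forall i : 'I_k, 'I_dP})) :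
    l2norm v = 1 -> complex.Re ((v^t* *m A *m v) 0 0) <= k%:R * s.
  move=> v1; rewrite -ler_pdivrMl // -(win_prob_prepare v1).
  by apply: ub_le_sup => //; exists (prepare v1).
have ks_ge0 : 0 <= k%:R * s by apply: le_trans (win_le _ w_unit); exact: ler_Re (A_psd w).
apply/eqP; rewrite eq_le; apply/andP; split.
  apply: ge_sup; first by exists (win_prob Psi (prepare w_unit)); exists (prepare w_unit).
  by move=> _ [S _ <-]; exact: win_prob_le.
(* It remains to bound the norm of [A *m v] on the unit ball by k s; the zero vector shows that this
   set of norms is nonempty. *)
rewrite ler_pdivrMl //; apply: ge_sup.
  by exists (l2norm (A *m 0)); exists 0; rewrite //= /l2norm mulmx0 mxE sqrtr0.
move=> _ [v /= v1 <-]; apply: le_trans (ler_piMr ks_ge0 v1).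
apply: psd_l2norm_le => // u.
have [u0|u0] := eqVneq (l2norm u) 0.
  by rewrite u0 (l2norm_eq0 u0) mulmx0 mxE expr0n mulr0.
have u_gt0 : 0 < l2norm u by rewrite lt_def u0 l2norm_ge0.
(* The bound [win_le] holds for unit vectors; normalising [u] extends it by homogeneity. *)
set c := l2norm u in u0 u_gt0 *; have cV_ge0 : 0 <= c^-1 by rewrite invr_ge0 ltW.
have := win_le (c^-1%:C%C *: u); rewrite l2normZ // mulVf // => /(_ erefl).
rewrite trmxCZ_real -!scalemxAl -scalemxAr scalerA -rmorphM [X in complex.Re X]mxE Re_realM.
by rewrite -invfM ler_pdivrMl ?mulr_gt0 // mulrC expr2.
Qed.
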